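(* Suppose that (a) $f:\mathbb{R}^n\to\mathbb{R}$ is twice continuously differentiable and $\sigma_f$-weakly convex (i.e. $f(x)+(\sigma_f/2)\|x\|^2$ is convex), $\nabla f$ is Lipschitz continuous with modulus $\ell_f$, and $\nabla^2 f$ is Lipschitz continuous with modulus $L_f$; (b) $A\in\mathbb{R}^{m\times n}$ has full row rank, with $\gamma>0$ defined by $\gamma^2:=\lambda_{\min}(AA^\top)$; (c) $f$ is coercive, i.e. $f(x)\to\infty$ as $\|x\|\to\infty$; and (d) the parameters satisfy $\mu>\sigma_f$ and $$c_3:=\frac{\mu+\ell_f+c_1}{\gamma},\quad c_4:=\frac{\mu+c_1}{\gamma},\quad \rho>\max\left\{\frac{8(c_3^2+c_4^2)}{\mu},\frac{4\ell_f}{\gamma^2}\right\},\quad \beta:=\frac{4c_4^2}{\rho}.$$ Then the sequence $\{(x^k,u^k,y^k)\}_{k\in\mathbb{N}}$ generated by iNALM is bounded. Moreover, $$\lim_{k\to\infty}\|x^{k+1}-x^k\|=0,\qquad \lim_{k\to\infty}\|u^{k+1}-u^k\|=0,\qquad \lim_{k\to\infty}\|y^{k+1}-y^k\|=0.$$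
   Context: $[m]=\{1,\dots,m\}$; for $T\subseteq[m]$, $\overline T:=[m]\setminus T$ and $v_T$ is the subvector of $v$ indexed by $T$. $h(u):=\|u_+\|_0$ is the number of strictly positive entries of $u$. Data: $\lambda,\mu>0$, $b\in\mathbb{R}^m$. Define $$\mathcal L_\rho(x,u,y):=f(x)+\langle y,Ax+b-u\rangle+\tfrac\rho2\|Ax+b-u\|^2+\lambda h(u),\qquad \mathcal V_{\rho,\theta}(x,u,y,v):=\mathcal L_\rho(x,u,y)+\tfrac\theta2\|x-v\|^2,$$ $$g_k(x,u):=f(x)+\langle y^k,Ax+b-u\rangle+\tfrac\rho2\|Ax+b-u\|^2+\tfrac\mu2\|x-x^k\|^2 .$$ $\overline\ell_g>0$ is a Lipschitz modulus of $\nabla g_k$ valid for all $k$; $\sigma_g:=\mu-\sigma_f$. GSNewton applied to a function $g$ (with $G:=g+\lambda h$), with $\alpha\in(0,1/\overline\ell_g)$, $t\in(0,2/\overline\ell_g)$ and starting point $\zeta^0$: for $j=0,1,\dots$, with $\zeta^j=(x^j,u^j)$, $y^j:=-\nabla_ug(\zeta^j)$: (1) $\Gamma_j:=\{i\in[m]:[u^j+\alpha y^j]_i\in[0,\sqrt{2\alpha\lambda})\}$; (2) $u^{j+1/2}_i:=0$ for $i\in\Gamma_j$, $u^{j+1/2}_i:=[u^j+\alpha y^j]_i$ for $i\notin\Gamma_j$, $x^{j+1/2}:=x^j-t\nabla_xg(x^j,u^{j+1/2})$, $\zeta^{j+1/2}:=(x^{j+1/2},u^{j+1/2})$; (3) $\widetilde\zeta^{j+1}=(x,u)$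 solves $u_{\Gamma_j}=0$ and $H^{j+1/2}[x-x^{j+1/2};(u-u^{j+1/2})_{\overline\Gamma_j}]=-[\nabla_xg(\zeta^{j+1/2});(\nabla_ug(\zeta^{j+1/2}))_{\overline\Gamma_j}]$, where $H^{j+1/2}$ is the Hessian of $g$ at $\zeta^{j+1/2}$ in the variables $(x,u_{\overline\Gamma_j})$; (4) $\zeta^{j+1}:=\widetilde\zeta^{j+1}$ if $G(\zeta^{j+1/2})-G(\widetilde\zeta^{j+1})\ge(\sigma_g/4)\|\widetilde\zeta^{j+1}-\zeta^{j+1/2}\|^2$, and $\zeta^{j+1}:=\zeta^{j+1/2}$ otherwise. Residuals: with $\Gamma:=\{i\in[m]:[u-\alpha\nabla_ug_k(x,u)]_i\in[0,\sqrt{2\alpha\lambda})\}$, $\mathcal R_1(x,u):=\|\nabla_xg_k(x,u)\|$, $\mathcal R_2(x,u):=\|[u_\Gamma;\ \alpha(\nabla_ug_k(x,u))_{\overline\Gamma}]\|$, $\mathcal R_3(x,u):=\frac{\alpha^2}2\|\nabla_ug_k(x,u)\|^2+\alpha\lambda\|u_+\|_0-\Phi_{\alpha\lambda h(\cdot)}(u-\alpha\nabla_ug_k(x,u))$, where $\Phi_{\alpha\lambda h(\cdot)}(v):=\min_{z}\{\alpha\lambda h(z)+\frac12\|z-v\|^2\}$. Algorithm iNALM: given $\epsilon_k>0$ with $\epsilon_k\to0$, $c_1,c_2>0$ and $(x^0,u^0,y^0)$. At iteration $k=0,1,\dots$: apply GSNewton to $g_k$ from $(x^k,u^k)$, generating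 $(x^{k,j},u^{k,j})$; stop as soon as an index $j_k$ satisfies $$\mathcal R_1(x^{k,j_k},u^{k,j_k})\le c_1\|x^{k,j_k}-x^k\|,\quad \mathcal R_2(x^{k,j_k},u^{k,j_k})\le c_2\|x^{k,j_k}-x^k\|^2,\quad \mathcal R_3(x^{k,j_k},u^{k,j_k})\le\epsilon_k,$$ and set $(x^{k+1},u^{k+1}):=(x^{k,j_k},u^{k,j_k})$; then $y^{k+1}:=y^k+\rho(Ax^{k+1}+b-u^{k+1})$. If the $x$-part of the limit of the GSNewton sequence equals $x^k$, then $(x^{k+1},u^{k+1})$ is instead taken to be a P-stationary point of $\min g_k+\lambda h$ satisfying these three inequalities (with $(x^{k+1},u^{k+1})$ in place of $(x^{k,j_k},u^{k,j_k})$). In all cases $\mathcal V_{\rho,\mu}(x^{k+1},u^{k+1},y^k,x^k)\le\mathcal V_{\rho,\mu}(x^k,u^k,y^k,x^k)$. *)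

(* Defs.v *)
From HB Require Import structures.
From mathcomp Require Import all_boot all_order all_algebra.
From mathcomp Require Import all_classical all_reals all_analysis.

Set Implicit Arguments.
Unset Strict Implicit.
Unset Printing Implicit Defensive.

Import Order.TTheory GRing.Theory Num.Theory.
Import numFieldNormedType.Exports.

Local Open Scope classical_set_scope.
Local Open Scope ring_scope.

(* The library norm `|x| on matrices is the max norm, hence a separate
   Euclidean norm; both induce the same topology, so the library notions of
   differentiability, continuity, convergence and boundedness can be used. *)
Definition dot (R : realType) n (u v : 'cV[R]_n) : R :=
  \sum_(i < n) u i 0 * v i 0.

Definition enorm (R : realType) n (v : 'cV[R]_n) : R := Num.sqrt (dot v v).

Definition spectral_norm (R : realType) p n (M : 'M[R]_(p, n)) : R :=
  sup [set enorm (M *m v) | v in [set v : 'cV[R]_n | enorm v <= 1]].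

(* Subvector indexed by T, entries listed in the order of [enum T]. *)
Definition subvec (R : realType) m (T : {set 'I_m}) (v : 'cV[R]_m) :
    'cV[R]_#|T| :=
  rowsub (fun i : 'I_#|T| => enum_val i) v.

(* The derivative notations are total; the gradients, Jacobians and Hessians
   below are meaningful for functions that are differentiable. *)
Definition grad (R : realType) n (f : 'cV[R]_n -> R) (x : 'cV[R]_n) :
    'cV[R]_n :=
  \col_i 'D_(delta_mx i 0) f x.

Definition jac (R : realType) n p (F : 'cV[R]_n -> 'cV[R]_p) (x : 'cV[R]_n) :
    'M[R]_(p, n) :=
  \matrix_(i, j) ('D_(delta_mx j 0) F x) i 0.

Definition hess (R : realType) n (f : 'cV[R]_n -> R) (x : 'cV[R]_n) :
    'M[R]_n :=
  jac (grad f) x.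

Definition twice_cont_diff (R : realType) n (f : 'cV[R]_n -> R) : Prop :=
  [/\ forall x, differentiable f x,
      forall x, differentiable (grad f) x
    & continuous (hess f)].

Definition weakly_convex (R : realType) n (s : R) (f : 'cV[R]_n -> R) : Prop :=
  convex_function setT (fun x : 'cV[R]_n => f x + s / 2 * enorm x ^+ 2).

Definition grad_lipschitz (R : realType) n (L : R) (f : 'cV[R]_n -> R) : Prop :=
  forall x x', enorm (grad f x - grad f x') <= L * enorm (x - x').

Definition hess_lipschitz (R : realType) n (L : R) (f : 'cV[R]_n -> R) : Prop :=
  forall x x', spectral_norm (hess f x - hess f x') <= L * enorm (x - x').

Definition coercive (R : realType) n (f : 'cV[R]_n -> R) : Prop :=
  forall M : R, exists r : R, forall x, r <= enorm x -> M <= f x.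

Definition is_lambda_min (R : realType) m (M : 'M[R]_m) (a : R) : Prop :=
  eigenvalue M a /\ forall c, eigenvalue M c -> a <= c.

Definition h (R : realType) m (u : 'cV[R]_m) : nat :=
  #|[set i : 'I_m | 0 < u i 0]%SET|.

Definition prox_obj (R : realType) m (phi : 'cV[R]_m -> R) (v z : 'cV[R]_m) :
    R :=
  phi z + 2^-1 * enorm (z - v) ^+ 2.

Definition prox (R : realType) m (phi : 'cV[R]_m -> R) (v : 'cV[R]_m) :
    set 'cV[R]_m :=
  [set z | forall z', prox_obj phi v z <= prox_obj phi v z'].

Definition moreau (R : realType) m (phi : 'cV[R]_m -> R) (v : 'cV[R]_m) : R :=
  inf (range (prox_obj phi v)).

Definition scaled_h (R : realType) m (c : R) (u : 'cV[R]_m) : R :=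
  c * (h u)%:R.

Definition calL (R : realType) n m (f : 'cV[R]_n -> R) (A : 'M[R]_(m, n))
    (b : 'cV[R]_m) (lam rho : R) (x : 'cV[R]_n) (u y : 'cV[R]_m) : R :=
  f x + dot y (A *m x + b - u) + rho / 2 * enorm (A *m x + b - u) ^+ 2
  + lam * (h u)%:R.

Definition calV (R : realType) n m (f : 'cV[R]_n -> R) (A : 'M[R]_(m, n))
    (b : 'cV[R]_m) (lam rho theta : R) (x : 'cV[R]_n) (u y : 'cV[R]_m)
    (v : 'cV[R]_n) : R :=
  calL f A b lam rho x u y + theta / 2 * enorm (x - v) ^+ 2.

(* [xk], [yk] are the current iterates of the outer algorithm. *)
Definition g_sub (R : realType) n m (f : 'cV[R]_n -> R) (A : 'M[R]_(m, n))
    (b : 'cV[R]_m) (rho mu : R) (xk : 'cV[R]_n) (yk : 'cV[R]_m)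
    (x : 'cV[R]_n) (u : 'cV[R]_m) : R :=
  f x + dot yk (A *m x + b - u) + rho / 2 * enorm (A *m x + b - u) ^+ 2
  + mu / 2 * enorm (x - xk) ^+ 2.

Definition grad_x (R : realType) n m (g : 'cV[R]_n -> 'cV[R]_m -> R)
    (x : 'cV[R]_n) (u : 'cV[R]_m) : 'cV[R]_n :=
  grad (fun x' => g x' u) x.

Definition grad_u (R : realType) n m (g : 'cV[R]_n -> 'cV[R]_m -> R)
    (x : 'cV[R]_n) (u : 'cV[R]_m) : 'cV[R]_m :=
  grad (g x) u.

Definition grad_xu (R : realType) n m (g : 'cV[R]_n -> 'cV[R]_m -> R)
    (x : 'cV[R]_n) (u : 'cV[R]_m) : 'cV[R]_(n + m) :=
  col_mx (grad_x g x u) (grad_u g x u).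

Definition grad_xu_lipschitz (R : realType) n m (L : R)
    (g : 'cV[R]_n -> 'cV[R]_m -> R) : Prop :=
  forall x u x' u',
    enorm (grad_xu g x u - grad_xu g x' u')
      <= L * enorm (col_mx (x - x') (u - u')).

(* Hessian of g at (x, u) in the variables (x, u_T). *)
Definition hess_sub (R : realType) n m (g : 'cV[R]_n -> 'cV[R]_m -> R)
    (T : {set 'I_m}) (x : 'cV[R]_n) (u : 'cV[R]_m) : 'M[R]_(n + #|T|) :=
  let e := fun i : 'I_#|T| => enum_val i in
  block_mx (jac (fun x' => grad_x g x' u) x) (colsub e (jac (grad_x g x) u))
           (rowsub e (jac (fun x' => grad_u g x' u) x))
           (mxsub e e (jac (grad_u g x) u)).

Definition Gamma_set (R : realType) n m (g : 'cV[R]_n -> 'cV[R]_m -> R)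
    (lam alpha : R) (x : 'cV[R]_n) (u : 'cV[R]_m) : {set 'I_m} :=
  let w := u - alpha *: grad_u g x u in
  [set i : 'I_m | (0 <= w i 0) && (w i 0 < Num.sqrt (2 * alpha * lam))]%SET.

Definition gs_half (R : realType) n m (g : 'cV[R]_n -> 'cV[R]_m -> R)
    (lam alpha t : R) (z : 'cV[R]_n * 'cV[R]_m) : 'cV[R]_n * 'cV[R]_m :=
  let y := - grad_u g z.1 z.2 in
  let Gamma := Gamma_set g lam alpha z.1 z.2 in
  let uh := \col_i (if i \in Gamma then 0 else (z.2 + alpha *: y) i 0) in
  (z.1 - t *: grad_x g z.1 uh, uh).

Definition newton_system (R : realType) n m (g : 'cV[R]_n -> 'cV[R]_m -> R)
    (Gamma : {set 'I_m}) (zh zt : 'cV[R]_n * 'cV[R]_m) : Prop :=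
  subvec Gamma zt.2 = 0 /\
  hess_sub g (~: Gamma) zh.1 zh.2
    *m col_mx (zt.1 - zh.1) (subvec (~: Gamma) (zt.2 - zh.2))
  = - col_mx (grad_x g zh.1 zh.2) (subvec (~: Gamma) (grad_u g zh.1 zh.2)).

Definition gs_step (R : realType) n m (g : 'cV[R]_n -> 'cV[R]_m -> R)
    (lam alpha t sigma_g : R) (z z' : 'cV[R]_n * 'cV[R]_m) : Prop :=
  let G (w : 'cV[R]_n * 'cV[R]_m) := g w.1 w.2 + lam * (h w.2)%:R in
  let zh := gs_half g lam alpha t z in
  exists zt : 'cV[R]_n * 'cV[R]_m,
    newton_system g (Gamma_set g lam alpha z.1 z.2) zh zt /\
    z' = if sigma_g / 4 * enorm (col_mx (zt.1 - zh.1) (zt.2 - zh.2)) ^+ 2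
              <= G zh - G zt
         then zt else zh.

Definition GSNewton (R : realType) n m (g : 'cV[R]_n -> 'cV[R]_m -> R)
    (lam alpha t sigma_g : R) (z0 : 'cV[R]_n * 'cV[R]_m)
    (z : nat -> 'cV[R]_n * 'cV[R]_m) : Prop :=
  z 0%N = z0 /\ forall j, gs_step g lam alpha t sigma_g (z j) (z j.+1).

Definition res1 (R : realType) n m (g : 'cV[R]_n -> 'cV[R]_m -> R)
    (x : 'cV[R]_n) (u : 'cV[R]_m) : R :=
  enorm (grad_x g x u).

Definition res2 (R : realType) n m (g : 'cV[R]_n -> 'cV[R]_m -> R)
    (lam alpha : R) (x : 'cV[R]_n) (u : 'cV[R]_m) : R :=
  let Gamma := Gamma_set g lam alpha x u in
  enorm (col_mx (subvec Gamma u) (alpha *: subvec (~: Gamma) (grad_u g x u))).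

Definition res3 (R : realType) n m (g : 'cV[R]_n -> 'cV[R]_m -> R)
    (lam alpha : R) (x : 'cV[R]_n) (u : 'cV[R]_m) : R :=
  alpha ^+ 2 / 2 * enorm (grad_u g x u) ^+ 2 + alpha * lam * (h u)%:R
  - moreau (scaled_h (alpha * lam)) (u - alpha *: grad_u g x u).

(* P-stationarity for min g + lam h; the proximal parameter [tau] is not tied
   to the step size of GSNewton. *)
Definition P_stationary (R : realType) n m (g : 'cV[R]_n -> 'cV[R]_m -> R)
    (lam : R) (x : 'cV[R]_n) (u : 'cV[R]_m) : Prop :=
  exists2 tau : R, 0 < tau &
    grad_x g x u = 0 /\
    prox (scaled_h (tau * lam)) (u - tau *: grad_u g x u) u.

Definition inexact_ok (R : realType) n m (g : 'cV[R]_n -> 'cV[R]_m -> R)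
    (lam alpha c1 c2 e : R) (xk x : 'cV[R]_n) (u : 'cV[R]_m) : Prop :=
  [/\ res1 g x u <= c1 * enorm (x - xk),
      res2 g lam alpha x u <= c2 * enorm (x - xk) ^+ 2
    & res3 g lam alpha x u <= e].

(* (x', u') is obtained from the inner sequence z started at (xk, uk).  The
   stopping index is the first one passing the inexactness test. *)
Definition iNALM_inner (R : realType) n m (g : 'cV[R]_n -> 'cV[R]_m -> R)
    (lam alpha c1 c2 e : R) (xk : 'cV[R]_n) (z : nat -> 'cV[R]_n * 'cV[R]_m)
    (x' : 'cV[R]_n) (u' : 'cV[R]_m) : Prop :=
  let ok := inexact_ok g lam alpha c1 c2 e xk in
  ((fun j => (z j).1) @ \oo --> xk -> P_stationary g lam x' u' /\ ok x' u') /\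
  (~ ((fun j => (z j).1) @ \oo --> xk) ->
     exists jk : nat,
       [/\ ok (z jk).1 (z jk).2,
           forall j, (j < jk)%N -> ~ ok (z j).1 (z j).2
         & (x', u') = z jk]).

(* The sequences (x, u, y) are generated by the inexact Newton augmented
   Lagrangian method, from the starting point (x 0, u 0, y 0). *)
Definition iNALM (R : realType) n m (f : 'cV[R]_n -> R) (A : 'M[R]_(m, n))
    (b : 'cV[R]_m) (lam mu rho sigma_f alpha t c1 c2 : R) (eps : nat -> R)
    (x : nat -> 'cV[R]_n) (u y : nat -> 'cV[R]_m) : Prop :=
  forall k : nat,
    let gk := g_sub f A b rho mu (x k) (y k) in
    [/\ exists2 z : nat -> 'cV[R]_n * 'cV[R]_m,
          GSNewton gk lam alpha t (mu - sigma_f) (x k, u k) z &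
          iNALM_inner gk lam alpha c1 c2 (eps k) (x k) z (x k.+1) (u k.+1),
        y k.+1 = y k + rho *: (A *m x k.+1 + b - u k.+1)
      & calV f A b lam rho mu (x k.+1) (u k.+1) (y k) (x k)
          <= calV f A b lam rho mu (x k) (u k) (y k) (x k)].

(* Main.v *)
(* Stationarity of the inexact subproblems gives
   A^T y^(k+1) = - grad f(x^(k+1)) - mu (x^(k+1) - x^k) + error,
   with an error of norm at most c1 |x^(k+1) - x^k|, and |A^T y| >= gamma |y|,
   so the multiplier steps are controlled by two consecutive primal steps.
   Hence the augmented Lagrangian plus (beta / 2) |x^(k+1) - x^k|^2 decreases
   by at least (mu / 4) |x^(k+2) - x^(k+1)|^2.  It is bounded below: with
   l := rho gamma^2 / 4 > l_f, the inequality |grad f|^2 <= 2 l (f - inf f)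
   shows that |y|^2 / (2 rho) takes away at most half of f - inf f, up to a
   multiple of |x^(k+1) - x^k|^2 that the added term absorbs. *)
Require Import Defs.
From HB Require Import structures.
From mathcomp Require Import all_boot all_order all_algebra.
From mathcomp Require Import all_classical all_reals all_analysis.
From mathcomp Require Import ring lra.

Set Implicit Arguments.
Unset Strict Implicit.
Unset Printing Implicit Defensive.

Import Order.TTheory GRing.Theory Num.Theory.
Import numFieldNormedType.Exports.

Local Open Scope classical_set_scope.
Local Open Scope ring_scope.

(** * Euclidean inner product and norm, and the Rayleigh quotient of a symmetric matrix *)

Section Euclidean.
Context {R : realType}.

Lemma dotC n (u v : 'cV[R]_n) : dot u v = dot v u.
Proof. by apply: eq_bigr => i _; rewrite mulrC. Qed.

Lemma dotDl n (u v w : 'cV[R]_n) : dot (u + v) w = dot u w + dot v w.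
Proof. by rewrite -big_split; apply: eq_bigr => i _; rewrite mxE mulrDl. Qed.

Lemma dotZl n (a : R) (u v : 'cV[R]_n) : dot (a *: u) v = a * dot u v.
Proof. by rewrite mulr_sumr; apply: eq_bigr => i _; rewrite mxE mulrA. Qed.

Lemma dotNl n (u v : 'cV[R]_n) : dot (- u) v = - dot u v.
Proof. by rewrite -scaleN1r dotZl mulN1r. Qed.

Lemma dotDr n (u v w : 'cV[R]_n) : dot w (u + v) = dot w u + dot w v.
Proof. by rewrite dotC dotDl !(dotC w). Qed.

Lemma dotZr n (a : R) (u v : 'cV[R]_n) : dot v (a *: u) = a * dot v u.
Proof. by rewrite dotC dotZl dotC. Qed.

Lemma dotNr n (u v : 'cV[R]_n) : dot u (- v) = - dot u v.
Proof. by rewrite dotC dotNl dotC. Qed.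

Definition dotE := (dotDl, dotDr, dotZl, dotZr, dotNl, dotNr).

Lemma dot_delta n (u : 'cV[R]_n) i : dot u (delta_mx i 0) = u i 0.
Proof.
rewrite /dot (bigD1 i)//= big1 => [|j ji]; last by rewrite mxE (negPf ji) mulr0.
by rewrite mxE !eqxx mulr1 addr0.
Qed.

Lemma dot_mulmxl m n (M : 'M[R]_(m, n)) u v :
  dot (M *m u) v = dot u (M^T *m v).
Proof.
rewrite /dot.
under eq_bigr do rewrite mxE mulr_suml.
under [RHS]eq_bigr do rewrite mxE mulr_sumr.
rewrite exchange_big; apply: eq_bigr => i _; apply: eq_bigr => j _.
by rewrite mxE mulrAC mulrC mulrA mulrAC -mulrA mulrC.
Qed.

Lemma dot_ge0 n (u : 'cV[R]_n) : 0 <= dot u u.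
Proof. by apply: sumr_ge0 => i _; rewrite -expr2 sqr_ge0. Qed.

Lemma enorm_ge0 n (u : 'cV[R]_n) : 0 <= enorm u.
Proof. exact: sqrtr_ge0. Qed.

Lemma sqr_enorm n (u : 'cV[R]_n) : enorm u ^+ 2 = dot u u.
Proof. by rewrite sqr_sqrtr// dot_ge0. Qed.

Lemma enormN n (u : 'cV[R]_n) : enorm (- u) = enorm u.
Proof. by rewrite /enorm dotNl dotNr opprK. Qed.

Lemma enormB n (u v : 'cV[R]_n) : enorm (u - v) = enorm (v - u).
Proof. by rewrite -enormN opprB. Qed.

Lemma enormZ n (a : R) (u : 'cV[R]_n) : enorm (a *: u) = `|a| * enorm u.
Proof.
by rewrite /enorm dotZl dotZr mulrA -expr2 sqrtrM ?sqr_ge0// sqrtr_sqr.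
Qed.

Lemma normr_coord_le_enorm n (u : 'cV[R]_n) i : `|u i 0| <= enorm u.
Proof.
rewrite -(@ler_pXn2r _ 2) ?nnegrE ?enorm_ge0// sqr_enorm real_normK ?num_real//.
rewrite /dot (bigD1 i)//= -expr2 lerDl.
by apply: sumr_ge0 => j _; rewrite -expr2 sqr_ge0.
Qed.

(** Transfers Euclidean bounds to the max norm, in which boundedness is finally stated. *)
Lemma norm_le_enorm n (u : 'cV[R]_n) : `|u| <= enorm u.
Proof.
rewrite /Num.norm/= mx_normrE; apply/bigmax_leP; split=> [|[i j] _ /=].
  exact: enorm_ge0.
by rewrite (ord1 j) normr_coord_le_enorm.
Qed.

Lemma enorm_eq0 n (u : 'cV[R]_n) : (enorm u == 0) = (u == 0).
Proof.
apply/eqP/eqP => [u0|->]; last first.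
  by rewrite /enorm -(scale0r 0) dotZl mul0r sqrtr0.
by apply/eqP; rewrite -normr_le0 -u0 norm_le_enorm.
Qed.

Lemma enorm0 n : enorm (0 : 'cV[R]_n) = 0.
Proof. by apply/eqP; rewrite enorm_eq0. Qed.

(** Cauchy-Schwarz: with a = |u| and b = |v|, the square of b u - a v expands to 2ab(ab - <u,v>). *)
Lemma dot_le_enorm n (u v : 'cV[R]_n) : dot u v <= enorm u * enorm v.
Proof.
have [->|u0] := eqVneq u 0.
  by rewrite -(scale0r 0) dotZl mul0r mulr_ge0 ?enorm_ge0.
have [->|v0] := eqVneq v 0.
  by rewrite -(scale0r 0) dotZr mul0r mulr_ge0 ?enorm_ge0.
have {}u0 : 0 < enorm u by rewrite lt_neqAle eq_sym enorm_eq0 u0 enorm_ge0.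
have {}v0 : 0 < enorm v by rewrite lt_neqAle eq_sym enorm_eq0 v0 enorm_ge0.
have := dot_ge0 (enorm v *: u - enorm u *: v).
rewrite !dotE -!sqr_enorm (dotC v u).
set a := enorm u in u0 *; set b := enorm v in v0 *; set d := dot u v.
rewrite (_ : _ + _ = 2 * (a * b) * (a * b - d)); last by ring.
by rewrite pmulr_rge0 ?subr_ge0// !mulr_gt0.
Qed.

Lemma enormD n (u v : 'cV[R]_n) : enorm (u + v) <= enorm u + enorm v.
Proof.
rewrite -(@ler_pXn2r _ 2) ?nnegrE ?addr_ge0 ?enorm_ge0//.
rewrite sqrrD !sqr_enorm !dotE (dotC v u).
have := dot_le_enorm u v; rewrite mulr2n; lra.
Qed.

(** Cauchy-Schwarz on each row gives the Frobenius norm as a bound; adding 1 makes the constant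
    positive even for M = 0. *)
Lemma mulmx_enorm_bound m n (M : 'M[R]_(m, n)) :
  exists2 K, 0 < K & forall v, enorm (M *m v) <= K * enorm v.
Proof.
pose r i : 'cV[R]_n := (row i M)^T.
pose s := \sum_i enorm (r i) ^+ 2.
have s0 : 0 <= s by apply: sumr_ge0 => i _; exact: sqr_ge0.
exists (Num.sqrt s + 1) => [|v]; first by rewrite ltr_wpDl ?sqrtr_ge0.
apply: (@le_trans _ _ (Num.sqrt s * enorm v)); last first.
  by rewrite ler_wpM2r ?enorm_ge0// lerDl.
rewrite -(@ler_pXn2r _ 2) ?nnegrE ?mulr_ge0 ?enorm_ge0 ?sqrtr_ge0//.
rewrite exprMn (sqr_sqrtr s0) /s mulr_suml sqr_enorm; apply: ler_sum => i _.
have -> : (M *m v) i 0 = dot (r i) v.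
  by rewrite mxE; apply: eq_bigr => j _; rewrite !mxE.
rewrite -expr2 -exprMn -[leLHS]real_normK ?num_real//.
rewrite ler_pXn2r ?nnegrE ?mulr_ge0 ?enorm_ge0// ler_norml dot_le_enorm.
by rewrite lerNl -dotNl -(enormN (r i)) dot_le_enorm.
Qed.

(* With [E] the set of lower bounds of the Rayleigh quotient, [sup E] is an
   eigenvalue: otherwise the nonnegative form of [S - (sup E)%:M] comes from an
   invertible matrix, so it dominates a positive multiple of [dot z z] and
   [sup E] could be increased. *)
Lemma lambda_min_le_dot n (S : 'M[R]_n) a (y : 'cV[R]_n) :
  S^T = S -> is_lambda_min S a -> a * dot y y <= dot y (S *m y).
Proof.
move=> symS [/eigenvalueP[v Sv v0] amin].
pose E := [set c | forall z : 'cV[R]_n, c * dot z z <= dot z (S *m z)].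
have [K K0 SK] := mulmx_enorm_bound S.
have supE : has_sup E.
  split.
    exists (- K) => z; have := dot_le_enorm (- z) (S *m z).
    rewrite dotNl enormN => zS; rewrite -sqr_enorm.
    have := ler_wpM2l (enorm_ge0 z) (SK z); rewrite expr2; lra.
  (* [eigenvalue] provides a row eigenvector. Symmetry makes its transpose a column eigenvector with
     Rayleigh quotient a, which caps [E]. *)
  exists a => c /(_ v^T).
  have -> : S *m v^T = a *: v^T by rewrite -{1}symS -trmx_mul Sv linearZ.
  rewrite dotZr ler_pM2r// -sqr_enorm exprn_gt0// lt_neqAle eq_sym enorm_ge0.
  by rewrite andbT enorm_eq0 trmx_eq0.
have Ec : E (sup E).
  move=> z; apply/ler_addgt0Pr => e e0.
  (* The supremum is attained since [E] is closed; the [+ 1] keeps the tolerance meaningful at z =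
     0. *)
  have q0 : 0 < dot z z + 1 by rewrite ltr_wpDl ?dot_ge0.
  have [c Ec /ltW ce] := sup_adherent (divr_gt0 e0 q0) supE.
  have := ler_wpM2r (dot_ge0 z) ce; have := Ec z.
  have : e / (dot z z + 1) * dot z z <= e.
    by rewrite mulrAC ler_pdivrMr// ler_wpM2l ?ltW// ltrDl.
  lra.
suff /amin ac : eigenvalue S (sup E).
  by apply: le_trans (Ec y); rewrite ler_wpM2r ?dot_ge0.
set c := sup E in Ec *.
apply: contrapT => /negP; rewrite negbK => /eqP kerN.
pose N := S - c%:M.
have unitN : N \in unitmx by rewrite -row_free_unit -kermx_eq0; apply/eqP.
have symN : N^T = N by rewrite /N linearB/= tr_scalar_mx symS.
have qN z : dot z (N *m z) = dot z (S *m z) - c * dot z z.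
  by rewrite mulmxBl dotDr dotNr mul_scalar_mx dotZr.
have qN0 z : 0 <= dot z (N *m z) by rewrite qN subr_ge0.
have [K1 K10 NK1] := mulmx_enorm_bound (invmx N).
have [K2 K20 NK2] := mulmx_enorm_bound N.
(* Evaluate the nonnegative form of [N] at [z - (N z) / K2]. *)
have NzK z : enorm (N *m z) ^+ 2 <= K2 * dot z (N *m z).
  set w := N *m z.
  have := qN0 (z - K2^-1 *: w).
  rewrite mulmxBr -scalemxAr !dotE -/w.
  have -> : dot z (N *m w) = dot w w by rewrite -[in LHS]symN -dot_mulmxl.
  have := le_trans (dot_le_enorm w _) (ler_wpM2l (enorm_ge0 w) (NK2 w)).
  rewrite mulrCA -expr2 -sqr_enorm => wNw.
  have i0 : 0 < K2^-1 by rewrite invr_gt0.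
  have := ler_wpM2l (ltW (mulr_gt0 i0 i0)) wNw.
  rewrite -[K2^-1 * _ * (K2 * _)]mulrA mulKf ?gt_eqF// => wNw'.
  rewrite sqr_enorm in wNw'; rewrite sqr_enorm -ler_pdivrMl//.
  lra.
(* Since |z| <= K1 |Nz| and |Nz|^2 <= K2 <z,Nz>, this is an admissible increase of c. *)
have K0' : 0 < (K1 ^+ 2 * K2)^-1 by rewrite invr_gt0 mulr_gt0// exprn_gt0.
suff : E (c + (K1 ^+ 2 * K2)^-1).
  by move/(ub_le_sup supE.2); rewrite -/c gerDl leNgt K0'.
move=> z; rewrite mulrDl -lerBrDl -qN mulrC ler_pdivrMr ?mulr_gt0 ?exprn_gt0//.
have := NK1 (N *m z); rewrite mulKmx// => zN.
rewrite -sqr_enorm; apply: (@le_trans _ _ ((K1 * enorm (N *m z)) ^+ 2)).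
  by rewrite ler_pXn2r ?nnegrE ?mulr_ge0 ?enorm_ge0 ?(ltW K10).
rewrite exprMn [leRHS]mulrC -[leRHS]mulrA.
by rewrite ler_pM2l ?exprn_gt0.
Qed.
End Euclidean.

(** * Directional derivatives, the descent lemma and gradient bounds *)

Section Gradient.
Context {R : realType}.

(** The difference quotient is a + s c. This differentiates the quadratic terms by expanding them
    along a line. *)
Lemma is_derive_quadratic (V : normedModType R) (q : V -> R) x v a c :
  (forall s, q (s *: v + x) = q x + s * a + s ^+ 2 * c) -> is_derive x v q a.
Proof.
move=> qE.
have cvq : (fun s : R => s^-1 *: ((q \o shift x) (s *: v) - q x)) @ 0^' --> a.
  have : (fun s : R => a + s * c) @ 0^' --> a + 0 * c.
    apply: cvgD; first exact: cvg_cst.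
    by apply: cvgMl; exact: cvg_within.
  rewrite mul0r addr0.
  apply: cvg_trans; apply: near_eq_cvg; near=> s.
  have s0 : s != 0 by near: s; exact: nbhs_dnbhs_neq.
  rewrite /= qE /GRing.scale/=; field.
  exact: s0.
split; first exact: cvgP cvq.
exact: cvg_lim cvq.
Unshelve. all: by end_near. Qed.

Lemma derive_dot_grad n (f : 'cV[R]_n -> R) x v :
  differentiable f x -> 'D_v f x = dot (grad f x) v.
Proof.
move=> df; rewrite deriveE//.
have {1}-> : v = \sum_i v i 0 *: delta_mx i 0.
  by rewrite {1}[v]matrix_sum_delta; apply: eq_bigr => i _; rewrite big_ord1.
rewrite linear_sum; apply: eq_bigr => i _.
by rewrite linearZ/= -deriveE// mxE mulrC.
Qed.

Lemma is_derive_line n (f : 'cV[R]_n -> R) x v (s : R) :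
  differentiable f (x + s *: v) ->
  is_derive s 1 (fun t : R => f (x + t *: v)) (dot (grad f (x + s *: v)) v).
Proof.
move=> df; rewrite -derive_dot_grad//.
have E : (fun t : R =>
    t^-1 *: (((fun t0 : R => f (x + t0 *: v)) \o shift s) (t *: 1)
      - f (x + s *: v))) =
  (fun t => t^-1 *: ((f \o shift (x + s *: v)) (t *: v) - f (x + s *: v))).
  apply/funext => t /=; congr (_ *: (f _ - _)).
  by rewrite [t *: 1]mulr1 scalerDl addrCA.
split; first by rewrite /derivable E; exact: diff_derivable.
by rewrite /derive E.
Qed.

(** Descent lemma without integrals: [phi] has a nonpositive derivative on [0, 1] by Cauchy-Schwarz
    and the Lipschitz bound, so phi(1) <= phi(0). *)
Lemma grad_lipschitz_le n (f : 'cV[R]_n -> R) l x v :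
  (forall z, differentiable f z) -> grad_lipschitz l f ->
  f (x + v) <= f x + dot (grad f x) v + l / 2 * enorm v ^+ 2.
Proof.
move=> df lf.
pose phi (s : R) := f (x + s *: v)
  + (- (s * dot (grad f x) v) - s ^+ 2 * (l / 2 * enorm v ^+ 2)).
have dphi (s : R) : is_derive s 1 phi (dot (grad f (x + s *: v)) v
    - dot (grad f x) v - l * s * enorm v ^+ 2).
  rewrite -addrA; apply: is_deriveD; first exact: is_derive_line.
  apply: (@is_derive_quadratic _ _ _ _ _ (- (l / 2 * enorm v ^+ 2))) => t.
  by rewrite [t *: 1]mulr1; field.
have cphi : {within `[0, 1], continuous phi}.
  apply: derivable_within_continuous => s _; exact: ex_derive.
have : phi 1 <= phi 0.
  apply: (@ler0_derive1_le_cc _ phi 0 1 _ _ cphi) => //=;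
    rewrite ?in_itv/= ?lexx ?ler01//.
  move=> s; rewrite in_itv/= => /andP[s0 s1]; rewrite derive1E derive_val.
  rewrite subr_le0 -dotNl -dotDl.
  apply: (le_trans (dot_le_enorm _ _)).
  have := lf (x + s *: v) x; rewrite [x + _]addrC addrK.
  rewrite enormZ gtr0_norm// mulrA expr2 mulrA => h.
  by rewrite ler_wpM2r ?enorm_ge0.
rewrite /phi scale1r scale0r addr0; lra.
Qed.

(** The gradient step x - grad f(x) / l lowers f by at least |grad f(x)|^2 / (2l), yet stays above
    [fmin]. *)
Lemma grad_lipschitz_sqr_le n (f : 'cV[R]_n -> R) l fmin x :
  (forall z, differentiable f z) -> grad_lipschitz l f -> 0 < l ->
  (forall z, fmin <= f z) -> enorm (grad f x) ^+ 2 <= 2 * l * (f x - fmin).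
Proof.
move=> df lf l0 fm.
have := grad_lipschitz_le x (- l^-1 *: grad f x) df lf.
move/(le_trans (fm _)).
rewrite dotZr -sqr_enorm enormZ exprMn normrN real_normK ?num_real//.
set a := _ ^+ 2 => fa.
have -> : a = 2 * l * (l^-1 * a - l / 2 * (l^-1 ^+ 2 * a)).
  by field; rewrite gt_eqF.
rewrite ler_pM2l; first lra.
lra.
Qed.

(** Coercivity gives f >= 0 outside a ball. Inside it, the descent lemma from x to 0 bounds f(x)
    below in terms of f(0), so compactness is not invoked. *)
Lemma coercive_lbound n (f : 'cV[R]_n -> R) l :
  (forall z, differentiable f z) -> grad_lipschitz l f -> coercive f ->
  exists c, forall x, c <= f x.
Proof.
move=> df lf /(_ 0)[r fr].
exists (Num.min 0 (f 0 - (enorm (grad f 0) + `|l| * `|r|) * `|r|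
  - `|l| * `|r| ^+ 2)) => x.
rewrite ge_min; case: (lerP r (enorm x)) => [/fr -> //|xr].
apply/orP; right.
have xr' : enorm x <= `|r| by apply: le_trans (ltW xr) (ler_norm _).
have := grad_lipschitz_le x (- x) df lf.
rewrite subrr dotNr enormN.
have := dot_le_enorm (- grad f x) x; rewrite dotNl enormN.
have gx : enorm (grad f x) <= enorm (grad f 0) + `|l| * `|r|.
  rewrite -[X in enorm X](subrK (grad f 0)) addrC.
  rewrite (le_trans (enormD _ _))// lerD2l.
  apply: (le_trans (lf _ _)); rewrite subr0.
  apply: (@le_trans _ _ (`|l| * enorm x)).
    by rewrite ler_wpM2r ?enorm_ge0 ?ler_norm.
  by rewrite ler_wpM2l.
have := ler_pM (enorm_ge0 _) (enorm_ge0 _) gx xr'.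
have : l / 2 * enorm x ^+ 2 <= `|l| * `|r| ^+ 2.
  apply: (@le_trans _ _ (`|l| * enorm x ^+ 2)).
    rewrite ler_wpM2r ?sqr_ge0//.
    have := ler_norm l; have := normr_ge0 l; lra.
  by rewrite ler_wpM2l// ler_pXn2r ?nnegrE ?enorm_ge0.
lra.
Qed.
End Gradient.

(** * Subproblem gradient, estimates for the augmented Lagrangian, and null sequences *)

Section AugmentedLagrangian.
Context {R : realType}.

(** |A^T y|^2 = <y, A A^T y>, to which the Rayleigh bound applies; dual vectors are thus controlled
    by their images under A^T. *)
Lemma gram_lambda_min_enorm m n (A : 'M[R]_(m, n)) gamma (y : 'cV[R]_m) :
  0 <= gamma -> is_lambda_min (A *m A^T) (gamma ^+ 2) ->
  gamma * enorm y <= enorm (A^T *m y).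
Proof.
move=> gamma0 lmin.
rewrite -(@ler_pXn2r _ 2) ?nnegrE ?mulr_ge0 ?enorm_ge0// exprMn !sqr_enorm.
rewrite dot_mulmxl trmxK mulmxA; apply: lambda_min_le_dot => //.
by rewrite trmx_mul trmxK.
Qed.

(** Everything except f is quadratic in x. At the new iterate, the vector under A^T is the updated
    multiplier. *)
Lemma grad_x_g_sub m n (f : 'cV[R]_n -> R) (A : 'M[R]_(m, n)) b rho mu
    xk yk x u :
  differentiable f x ->
  grad_x (g_sub f A b rho mu xk yk) x u =
  grad f x + A^T *m (yk + rho *: (A *m x + b - u)) + mu *: (x - xk).
Proof.
move=> df; apply/colP => i; rewrite mxE.
set v := delta_mx i 0; set r := A *m x + b - u.
pose q x' := dot yk (A *m x' + b - u) + rho / 2 * enorm (A *m x' + b - u) ^+ 2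
  + mu / 2 * enorm (x' - xk) ^+ 2.
have dq : is_derive x v q (dot (A^T *m (yk + rho *: r) + mu *: (x - xk)) v).
  apply: (@is_derive_quadratic _ _ _ _ _ _
    (rho / 2 * enorm (A *m v) ^+ 2 + mu / 2 * enorm v ^+ 2)) => s.
  rewrite /q.
  have -> : A *m (s *: v + x) + b - u = s *: (A *m v) + r.
    by rewrite mulmxDr -scalemxAr /r !addrA.
  rewrite -/r -[s *: v + x - xk]addrA; move: r (x - xk) => r z.
  rewrite !sqr_enorm !dotE [dot (A^T *m _) v]dot_mulmxl trmxK !dotE.
  by rewrite (dotC r) (dotC z v); field.
have -> : (fun x' => g_sub f A b rho mu xk yk x' u) = f + q.
  by apply/funext => x'; rewrite /g_sub /q fctE !addrA.
rewrite deriveD//; last exact: diff_derivable.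
by rewrite derive_val derive_dot_grad// -dotDl dot_delta addrA.
Qed.

(** The increase equals |y' - y|^2 / rho for the updated multiplier y'; the primal decrease has to
    pay for it. *)
Lemma calL_dual_step m n (f : 'cV[R]_n -> R) (A : 'M[R]_(m, n)) b lam rho x u y :
  calL f A b lam rho x u (y + rho *: (A *m x + b - u)) =
  calL f A b lam rho x u y + rho * enorm (A *m x + b - u) ^+ 2.
Proof.
by rewrite /calL; move: (_ + b - u) => r; rewrite !dotE sqr_enorm; ring.
Qed.

(** Complete the square: <y,r> + rho/2 |r|^2 = (|rho r + y|^2 - |y|^2) / (2 rho). *)
Lemma calL_lbound m n (f : 'cV[R]_n -> R) (A : 'M[R]_(m, n)) b lam rho x u y :
  0 <= lam -> 0 < rho ->
  f x - (2 * rho)^-1 * enorm y ^+ 2 <= calL f A b lam rho x u y.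
Proof.
move=> lam0 rho0; rewrite /calL; move: (_ + b - u) => r.
have := dot_ge0 (rho *: r + y).
rewrite !dotE (dotC y r) -!sqr_enorm => rE.
have /(mulr_ge0 lam0) := ler0n R (h u).
have i0 : 0 < (2 * rho)^-1 by rewrite invr_gt0 mulr_gt0.
have := mulr_ge0 (ltW i0) rE.
have -> : (2 * rho)^-1 * (rho * (rho * enorm r ^+ 2) + rho * dot r y
    + (rho * dot r y + enorm y ^+ 2)) =
  rho / 2 * enorm r ^+ 2 + dot r y + (2 * rho)^-1 * enorm y ^+ 2.
  by field; rewrite gt_eqF.
lra.
Qed.

(** A nonincreasing sequence bounded below converges, so its gaps vanish, and they dominate kappa
    d^2. *)
Lemma sufficient_decrease_cvg0 (phi d : nat -> R) (kappa c : R) :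
  0 < kappa -> (forall k, 0 <= d k) -> (forall k, c <= phi k) ->
  (forall k, phi k.+1 + kappa * d k ^+ 2 <= phi k) ->
  d @ \oo --> (0 : R).
Proof.
move=> kappa0 d0 cphi dec.
have phi_cvg : cvgn phi.
  apply: nonincreasing_is_cvgn; last by exists c => _ [k _ <-].
  apply/nonincreasing_seqP => k; apply: le_trans (dec k).
  by rewrite lerDl mulr_ge0 ?sqr_ge0// ltW.
have gap : (fun k => kappa^-1 * (phi k - phi k.+1)) @ \oo --> (0 : R).
  rewrite -(mulr0 kappa^-1) -(subrr (limn phi)).
  apply: cvgMr; apply: cvgB => //.
  by have := phi_cvg; rewrite -(cvg_shiftS phi).
have d2 : (fun k => d k ^+ 2) @ \oo --> (0 : R).
  apply: (squeeze_cvgr _ (cvg_cst 0) gap); apply: nearW => k.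
  by rewrite sqr_ge0/= ler_pdivlMl//; have := dec k; lra.
have := cvg_comp _ _ d2 (@sqrt_continuous R 0).
rewrite sqrtr0; apply: cvg_trans; apply: near_eq_cvg; apply: nearW => k /=.
by rewrite sqrtr_sqr ger0_norm.
Qed.

Lemma cvg_lin_comb0 (u v : nat -> R) a b :
  u @ \oo --> (0 : R) -> v @ \oo --> (0 : R) ->
  (fun k => a * u k + b * v k) @ \oo --> (0 : R).
Proof.
move=> u0 v0; suff : (fun k => a * u k + b * v k) @ \oo --> a * 0 + b * 0.
  by rewrite !mulr0 addr0.
by apply: cvgD; apply: cvgMr.
Qed.

End AugmentedLagrangian.

Theorem lemma12 (R : realType) (n m : nat)
    (f : 'cV[R]_n -> R) (A : 'M[R]_(m, n)) (b : 'cV[R]_m)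
    (lam mu rho sigma_f l_f L_f gamma lg alpha t c1 c2 c3 c4 beta : R)
    (eps : nat -> R)
    (x : nat -> 'cV[R]_n) (u y : nat -> 'cV[R]_m) :
  0 < lam -> 0 < mu ->
  twice_cont_diff f -> weakly_convex sigma_f f ->
  grad_lipschitz l_f f -> hess_lipschitz L_f f ->
  row_free A -> 0 < gamma -> is_lambda_min (A *m A^T) (gamma ^+ 2) ->
  coercive f ->
  sigma_f < mu ->
  c3 = (mu + l_f + c1) / gamma ->
  c4 = (mu + c1) / gamma ->
  Num.max (8 * (c3 ^+ 2 + c4 ^+ 2) / mu) (4 * l_f / gamma ^+ 2) < rho ->
  beta = 4 * c4 ^+ 2 / rho ->
  0 < lg ->
  (forall k, grad_xu_lipschitz lg (g_sub f A b rho mu (x k) (y k))) ->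
  0 < alpha < lg^-1 -> 0 < t < 2 / lg ->
  0 < c1 -> 0 < c2 ->
  (forall k, 0 < eps k) -> eps @ \oo --> (0 : R) ->
  iNALM f A b lam mu rho sigma_f alpha t c1 c2 eps x u y ->
  [/\ bounded_fun (fun k => (x k, u k, y k)),
      (fun k => enorm (x k.+1 - x k)) @ \oo --> (0 : R),
      (fun k => enorm (u k.+1 - u k)) @ \oo --> (0 : R)
    & (fun k => enorm (y k.+1 - y k)) @ \oo --> (0 : R)].
Proof.
move=> lam0 mu0 [df _ _] _ lf _ _ gamma0 lmin cf _ c3E c4E + _ _ _ _ _ c10.
move=> + _ _ _ alg; rewrite gt_max => /andP[rho_mu rho_l].
have g20 : 0 < gamma ^+ 2 by rewrite exprn_gt0.
have rho0 : 0 < rho.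
  apply: le_lt_trans rho_mu; rewrite divr_ge0 ?(ltW mu0)// mulr_ge0//.
  by rewrite addr_ge0 ?sqr_ge0.

(* Stationarity residual and multiplier bounds *)
pose d k := enorm (x k.+1 - x k).
pose e k := enorm (y k.+1 - y k).
have d0 k : 0 <= d k by exact: enorm_ge0.
have yE k : y k.+1 = y k + rho *: (A *m x k.+1 + b - u k.+1) by have [] := alg k.
(* By the dual update this vector is the x-gradient of the subproblem at the new point; both
   outcomes of the inner solver pass the first inexactness test. *)
have resid k : enorm (grad f (x k.+1) + A^T *m y k.+1 + mu *: (x k.+1 - x k))
    <= c1 * d k.
  have [[z _ [ok1 ok2]] _ _] := alg k.
  suff [+ _ _] : inexact_ok (g_sub f A b rho mu (x k) (y k)) lam alpha c1 c2
      (eps k) (x k) (x k.+1) (u k.+1).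
    by rewrite /res1 grad_x_g_sub// -yE.
  have [/ok1[] //|/ok2[j [okj _ zj]]] :=
    pselect ((fun j => (z j).1) @ \oo --> x k).
  by move: okj; rewrite -zj.
pose w k := grad f (x k.+1) + A^T *m y k.+1 + mu *: (x k.+1 - x k).
have ATyE k : A^T *m y k.+1 = w k - grad f (x k.+1) - mu *: (x k.+1 - x k).
  by rewrite /w addrAC addrK addrC addKr.
have y_le k : enorm (y k.+1) <= enorm (grad f (x k.+1)) / gamma + c4 * d k.
  rewrite c4E mulrAC -mulrDl ler_pdivlMr// mulrC.
  apply: le_trans (gram_lambda_min_enorm _ (ltW gamma0) lmin) _; rewrite ATyE.
  apply: le_trans (enormD _ _) _; rewrite enormN enormZ gtr0_norm// -/(d k).
  have := enormD (w k) (- grad f (x k.+1)); rewrite enormN.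
  by have := resid k; rewrite -/(w k); lra.
(* The index is shifted because both multipliers must come from a dual update; y^0 is arbitrary. The
   new residual contributes to c3, the old one to c4. *)
have e_le k : e k.+1 <= c3 * d k.+1 + c4 * d k.
  rewrite c3E c4E ![_ / gamma * _]mulrAC -mulrDl ler_pdivlMr// mulrC.
  apply: le_trans (gram_lambda_min_enorm _ (ltW gamma0) lmin) _.
  have -> : A^T *m (y k.+2 - y k.+1) = (w k.+1 - w k)
      + ((grad f (x k.+1) - grad f (x k.+2))
      + (mu *: (x k.+1 - x k) - mu *: (x k.+2 - x k.+1))).
    rewrite mulmxBr !ATyE.
    by apply/colP => i; rewrite !mxE; ring.
  apply: le_trans (enormD _ _) _.
  have := enormD (w k.+1) (- w k); rewrite enormN.
  have := enormD (grad f (x k.+1) - grad f (x k.+2))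
    (mu *: (x k.+1 - x k) - mu *: (x k.+2 - x k.+1)).
  have := enormD (mu *: (x k.+1 - x k)) (- (mu *: (x k.+2 - x k.+1))).
  rewrite enormN !enormZ gtr0_norm// -/(d k) -/(d k.+1).
  have := lf (x k.+2) (x k.+1); rewrite enormB -/(d k.+1).
  have := resid k; have := resid k.+1; rewrite -/(w k) -/(w k.+1).
  lra.

(* Lyapunov function: lower bound and descent *)
have sq_add_le (p q r : R) : 0 <= p -> p <= q + r ->
    p ^+ 2 <= 2 * q ^+ 2 + 2 * r ^+ 2.
  move=> p0 pqr; have := sqr_ge0 (q - r).
  have := ler_pM p0 p0 pqr pqr; rewrite -!expr2 !sqrrD sqrrN; lra.
(* A larger, positive Lipschitz modulus, chosen so that |grad f|^2 / (rho gamma^2) <= (f - fmin) /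
   2. *)
pose l := rho * gamma ^+ 2 / 4.
have l0 : 0 < l by rewrite divr_gt0// mulr_gt0.
have lfl : grad_lipschitz l f.
  move=> z z'; apply: le_trans (lf z z') _; rewrite ler_wpM2r ?enorm_ge0//.
  by move: rho_l; rewrite ltr_pdivrMr// /l; lra.
have [fmin fminP] := coercive_lbound df lfl cf.
have grad_le z : enorm (grad f z) ^+ 2 <= 2 * l * (f z - fmin).
  exact: grad_lipschitz_sqr_le.
have i0 : 0 < (2 * rho)^-1 by rewrite invr_gt0 mulr_gt0.
pose phi k := calL f A b lam rho (x k.+1) (u k.+1) (y k.+1)
  + 2 * c4 ^+ 2 / rho * d k ^+ 2.
have phi_ge k : (f (x k.+1) + fmin) / 2 <= phi k.
  have := calL_lbound f A b (x k.+1) (u k.+1) (y k.+1) (ltW lam0) rho0.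
  have /(ler_wpM2l (ltW i0)) := sq_add_le _ _ _ (enorm_ge0 _) (y_le k).
  have : (2 * rho)^-1 * (2 * (enorm (grad f (x k.+1)) / gamma) ^+ 2)
      <= (f (x k.+1) - fmin) / 2.
    rewrite ler_pdivrMl ?mulr_gt0// expr_div_n mulrA ler_pdivrMr//.
    by have := grad_le (x k.+1); rewrite /l; lra.
  rewrite /phi.
  (* The step part of |y|^2 / (2 rho) costs c4^2 d^2 / rho, half of the added term. *)
  have -> : 2 * c4 ^+ 2 / rho * d k ^+ 2
      = 2 * ((2 * rho)^-1 * (2 * (c4 * d k) ^+ 2)).
    by field; rewrite gt_eqF.
  have : 0 <= (2 * rho)^-1 * (2 * (c4 * d k) ^+ 2).
    by rewrite mulr_ge0 ?(ltW i0)// mulr_ge0 ?sqr_ge0.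
  rewrite mulrDr; lra.
(* The proximal term vanishes at the old point, so the primal step gains mu/2 d_{k+1}^2. The dual
   step and the new added term cost at most 2(c3^2 + c4^2)/rho <= mu/4 times d_{k+1}^2, plus the
   added term already in [phi k]. *)
have dec k : phi k.+1 + mu / 4 * d k.+1 ^+ 2 <= phi k.
  have [_ _] := alg k.+1; rewrite /calV subrr enorm0 expr0n/= mulr0 addr0.
  have r0 : 0 < rho^-1 by rewrite invr_gt0.
  have /(ler_wpM2l (ltW r0)) := sq_add_le _ _ _ (enorm_ge0 _) (e_le k).
  have -> : rho^-1 * e k.+1 ^+ 2
      = rho * enorm (A *m x k.+2 + b - u k.+2) ^+ 2.
    rewrite /e yE [y k.+1 + _]addrC addrK enormZ gtr0_norm//.
    by field; rewrite gt_eqF.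
  have : (2 * (c3 ^+ 2 + c4 ^+ 2) / rho) * d k.+1 ^+ 2 <= mu / 4 * d k.+1 ^+ 2.
    rewrite ler_wpM2r ?sqr_ge0// ler_pdivrMr//.
    by move: rho_mu; rewrite ltr_pdivrMr//; lra.
  rewrite /phi [y k.+2]yE calL_dual_step -/(d k.+1).
  lra.

(* Vanishing steps *)
have cvg_d : d @ \oo --> (0 : R).
  rewrite -cvg_shiftS.
  apply: (@sufficient_decrease_cvg0 _ phi _ (mu / 4) fmin) => [||k|k].
  - by rewrite divr_gt0.
  - by move=> k; exact: d0.
  - by apply: le_trans (phi_ge k); have := fminP (x k.+1); lra.
  - exact: dec.
have cvg_e : e @ \oo --> (0 : R).
  rewrite -cvg_shiftS.
  have bound0 : (fun k => c3 * d k.+1 + c4 * d k) @ \oo --> (0 : R).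
    by apply: cvg_lin_comb0; rewrite ?(cvg_shiftS d).
  apply: (squeeze_cvgr _ (cvg_cst 0) bound0); apply: nearW => k.
  by rewrite enorm_ge0 e_le.
have [K K0 AK] := mulmx_enorm_bound A.
(* Solving the dual update for u lets u inherit both convergence and boundedness from x and y. *)
have uE k : u k.+1 = A *m x k.+1 + b - rho^-1 *: (y k.+1 - y k).
  by rewrite yE [y k + _]addrC addrK scalerA mulVf ?gt_eqF// scale1r subKr.
have cvg_u : (fun k => enorm (u k.+1 - u k)) @ \oo --> (0 : R).
  rewrite -cvg_shiftS.
  have e2 : (fun k => e k.+1 + e k) @ \oo --> (0 : R).
    by rewrite -(addr0 0); apply: cvgD; rewrite ?(cvg_shiftS e).
  have bound0 :
      (fun k => K * d k.+1 + rho^-1 * (e k.+1 + e k)) @ \oo --> (0 : R).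
    by apply: cvg_lin_comb0; rewrite ?(cvg_shiftS d).
  apply: (squeeze_cvgr _ (cvg_cst 0) bound0); apply: nearW => k.
  rewrite enorm_ge0/= !uE.
  have -> : A *m x k.+2 + b - rho^-1 *: (y k.+2 - y k.+1)
      - (A *m x k.+1 + b - rho^-1 *: (y k.+1 - y k))
    = A *m (x k.+2 - x k.+1)
      + rho^-1 *: ((y k.+1 - y k) - (y k.+2 - y k.+1)).
    by rewrite mulmxBr; apply/colP => i; rewrite !mxE; ring.
  apply: le_trans (enormD _ _) _; rewrite lerD//.
  rewrite enormZ gtr0_norm ?invr_gt0// ler_pM2l ?invr_gt0//.
  by apply: le_trans (enormD _ _) _; rewrite enormN addrC.

(* Boundedness of the iterates *)
have bounded_tail p (s : nat -> 'cV[R]_p) B :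
    (forall k, enorm (s k.+1) <= B) -> exists B', forall k, enorm (s k) <= B'.
  (* The estimates hold only after one iteration; the arbitrary starting point enters through the
     maximum. *)
  move=> sB; exists (Num.max (enorm (s 0%N)) B) => -[|k].
    by rewrite le_max lexx.
  by rewrite le_max sB orbT.
have phi_le k : phi k <= phi 0%N.
  elim: k => // k; apply: le_trans; apply: le_trans (dec k).
  by rewrite lerDl mulr_ge0 ?sqr_ge0// divr_ge0 ?(ltW mu0).
have f_le k : f (x k.+1) <= 2 * phi 0%N - fmin.
  by have := phi_ge k; have := phi_le k; lra.
have [Bx xB] : exists B, forall k, enorm (x k) <= B.
  (* The [+ 1] turns the non-strict bound from coercivity into a contradiction with [f_le]. *)
  have [r rP] := cf (2 * phi 0%N - fmin + 1).
  apply: (bounded_tail _ _ r) => k; rewrite leNgt; apply/negP => /ltW /rP.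
  by have := f_le k; lra.
have [By yB] : exists B, forall k, enorm (y k) <= B.
  (* The gradient norm a is bounded through a <= 1 + a^2, which avoids a square root; each step of x
     is at most 2 Bx. *)
  apply: (bounded_tail _ _
    ((1 + 2 * l * (2 * phi 0%N - fmin - fmin)) / gamma + c4 * (Bx + Bx))) => k.
  apply: le_trans (y_le k) _; apply: lerD.
    rewrite ler_pM2r ?invr_gt0//.
    have := sqr_ge0 (enorm (grad f (x k.+1)) - 1).
    rewrite sqrrB expr1n mulr1 => sq.
    have := ler_wpM2l (ltW (mulr_gt0 (ltr0n R 2) l0)) (f_le k).
    have := grad_le (x k.+1); have := sqr_ge0 (enorm (grad f (x k.+1))).
    move: sq; rewrite mulr2n; lra.
  rewrite ler_wpM2l//; first by rewrite c4E divr_ge0 ?addr_ge0 ?ltW.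
  by apply: le_trans (enormD _ _) _; rewrite enormN lerD.
have [Bu uB] : exists B, forall k, enorm (u k) <= B.
  apply: (bounded_tail _ _ (K * Bx + enorm b + rho^-1 * (By + By))) => k.
  rewrite uE; apply: le_trans (enormD _ _) _; apply: lerD.
    apply: le_trans (enormD _ _) _; rewrite lerD2r.
    by apply: le_trans (AK _) _; rewrite ler_pM2l.
  rewrite enormN enormZ gtr0_norm ?invr_gt0// ler_pM2l ?invr_gt0//.
  by apply: le_trans (enormD _ _) _; rewrite enormN lerD.
split=> //.
exists (Num.max (Num.max Bx Bu) By); split=> [|B ltB k _ /=].
  exact: num_real.
apply: le_trans (ltW ltB); rewrite !prod_normE/= !ge_max !le_max.
rewrite (le_trans (norm_le_enorm _) (xB k)) (le_trans (norm_le_enorm _) (uB k)).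
by rewrite (le_trans (norm_le_enorm _) (yB k)) !orbT.
Qed.
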